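(* Let $n$ be a positive integer. For $1\leqslant i\leqslant n$ let $c_i:\{1,\ldots,n\}\to\{1,\ldots,n\}$ be the constant map with value $i$, and let $1_n$ be the identity map of $\{1,\ldots,n\}$. Then $\mathrm{swEnd}\,\vec{P}_n=\{c_i : 1\leqslant i\leqslant n\}\cup\{1_n\}$.
   Context: $\vec{P}_n$ denotes the directed path with vertex set $\{1,\ldots,n\}$ and edge set $E=\{(i,i+1) : i=1,\ldots,n-1\}$. $\mathrm{swEnd}\,\vec{P}_n$ denotes the set of all strong weak endomorphisms of $\vec{P}_n$, i.e. the maps $\alpha:\{1,\ldots,n\}\to\{1,\ldots,n\}$ such that, for all vertices $u,v$: ($(u,v)\in E$ and $u\alpha\neq v\alpha$) if and only if $(u\alpha,v\alpha)\in E$ (maps are written on the right of their arguments). *)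

(* Defs.v *)
From mathcomp Require Import all_boot.

Set Implicit Arguments.
Unset Strict Implicit.
Unset Printing Implicit Defensive.

Definition strong_weak_endo (T : finType) (e : rel T) (f : T -> T) : bool :=
  [forall u, forall v, (e u v && (f u != f v)) == e (f u) (f v)].

Definition swEnd (T : finType) (e : rel T) : {set {ffun T -> T}} :=
  [set f : {ffun T -> T} | strong_weak_endo e f].

(* The vertex k of {1, ..., n} is the ordinal of value k - 1. *)
Definition dipath (n : nat) : rel 'I_n := fun i j => i.+1 == j :> nat.

(* Main.v *)
Require Import Defs.
From mathcomp Require Import all_boot.
From mathcomp Require Import zify.

(** Along an edge [k -> k+1] a weak endomorphism of the path either stays put or
    moves one step forward.  The strong condition makes this choice the same at
    all edges ([step_constant]): if one of two consecutive steps were a stay and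
    the other a move, the images of [k] and [k+2] would be joined by an edge,
    although [k] and [k+2] are not.  So the map is affine of slope 0 or 1
    ([affine_slope]).  Slope 0 gives the constants; with slope 1 the last vertex
    is sent to [f 0 + (n - 1)], which stays inside the path only if [f 0 = 0],
    and the map is then the identity. *)

Section NatPath.

(** Here the path is an initial segment of the natural numbers, so that vertices
    can be added and subtracted without bound proofs. *)
Variables (n : nat) (g : nat -> nat).
Hypothesis g_strong : forall i j, i < n -> j < n ->
  ((i.+1 == j) && (g i != g j)) = ((g i).+1 == g j).

Lemma step_forward k : k.+1 < n -> g k.+1 = g k + (g k != g k.+1).
Proof.
move=> lt_k1n; have := g_strong _ _ (ltnW lt_k1n) lt_k1n.
rewrite eqxx /=; case: eqVneq => [-> | _ /esym/eqP <-]; first by rewrite addn0.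
by rewrite addn1.
Qed.

(** A stay next to a move would give an edge from [g k] to [g k.+2], hence one
    from [k] to [k.+2]. *)
Lemma step_constant k :
  k.+2 < n -> (g k != g k.+1) = (g k.+1 != g k.+2).
Proof.
move=> lt_k2n; have lt_k1n := ltnW lt_k2n.
have := g_strong _ _ (ltnW lt_k1n) lt_k2n; rewrite (ltn_eqF (ltnSn k.+1)) /=.
have := step_forward _ lt_k2n; have := step_forward _ lt_k1n.
by case: (g k != g k.+1); case: (g k.+1 != g k.+2); lia.
Qed.

Lemma affine_slope k : k < n -> g k = g 0 + (g 0 != g 1) * k.
Proof.
have slope0 j : j.+1 < n -> (g j != g j.+1) = (g 0 != g 1).
  by elim: j => // j IHj lt_j2n; rewrite -step_constant // IHj // ltnW.
elim: k => [|k IHk] lt_kn; first by rewrite muln0 addn0.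
by rewrite step_forward // slope0 // {1}IHk ?(ltnW lt_kn) // mulnS addnAC addnA.
Qed.

End NatPath.

Lemma const_swEnd n (i : 'I_n) : [ffun _ => i] \in swEnd (@dipath n).
Proof.
rewrite inE; apply/forallP=> u; apply/forallP=> v.
by rewrite !ffunE eqxx andbF /dipath gtn_eqF.
Qed.

Lemma id_swEnd n : [ffun x => x] \in swEnd (@dipath n).
Proof.
rewrite inE; apply/forallP=> u; apply/forallP=> v; rewrite !ffunE /dipath.
by case: (u =P v) => [-> | _]; rewrite ?andbT // gtn_eqF.
Qed.

Lemma swEnd_const_or_id n (f : {ffun 'I_n.+1 -> 'I_n.+1}) :
  f \in swEnd (@dipath n.+1) -> f = [ffun=> f ord0] \/ f = [ffun x => x].
Proof.
rewrite inE => /forallP f_strong.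
pose g k : nat := f (inord k).
have g_ord (x : 'I_n.+1) : g x = f x by rewrite /g inord_val.
have g_strong i j : i < n.+1 -> j < n.+1 ->
    ((i.+1 == j) && (g i != g j)) = ((g i).+1 == g j).
  move=> lt_in lt_jn; have /forallP/(_ (inord j))/eqP := f_strong (inord i).
  by rewrite /dipath !inordK.
have g_affine := affine_slope _ _ g_strong.
case: (g 0 != g 1) g_affine => g_affine; [right | left];
  apply/ffunP=> x; apply: val_inj; rewrite ffunE /= -g_ord g_affine //.
  (* The last vertex leaves no room for a translation. *)
  have := g_affine n (ltnSn n); have : g n < n.+1 := ltn_ord _.
  by lia.
by rewrite addn0 -g_ord.
Qed.

Theorem theorem1p4 (n : nat) (n_gt0 : 0 < n) :
  swEnd (@dipath n) =
    [set [ffun _ : 'I_n => i] | i : 'I_n] :|: [set [ffun x : 'I_n => x]].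
Proof.
case: n n_gt0 => // n _; apply/setP=> f; rewrite in_setU in_set1.
apply/idP/orP => [/swEnd_const_or_id[f_const | ->] | [/imsetP[i _ ->] | /eqP->]].
- by left; rewrite f_const imset_f.
- by right.
- exact: const_swEnd.
- exact: id_swEnd.
Qed.
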